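(* Let $G=(V,E)$ be a connected infinite plane graph satisfying the following conditions for some $\theta\in(0,\pi]$: (C1) there exists a non-zero vector $\bar x\in\mathbb{R}^2$ such that $V+\bar x\subset V$ and for all $u,v\in V$, $\{u,v\}\in E\iff\{u+\bar x,v+\bar x\}\in E$; (C2) there exists a point $O\in\mathbb{R}^2$ such that, with $R_\theta$ the rotation of the plane with center $O$ and angle $\theta$, $R_\theta(V)\subset V$ and for all $u,v\in V$, $\{u,v\}\in E\iff\{R_\theta(u),R_\theta(v)\}\in E$; (C3) each ball in $\mathbb{R}^2$ contains a finite number of vertices of $G$. Then $\theta\in\{\frac{\pi}{3},\frac{\pi}{2},\frac{2}{3}\pi,\pi\}$. Moreover, if $\theta\in\{\frac{\pi}{3},\frac{\pi}{2},\frac{2}{3}\pi\}$, then $G$ is either transitive or quasi-transitive.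
   Context: An arc is a subset of $\mathbb{R}^2$ that is a union of finitely many segments and is homeomorphic to $[0,1]$; its interior is the arc minus its two endpoints. A plane graph is a pair $G=(V,E)$ such that $V\subset\mathbb{R}^2$ is at most countable; every edge is an arc between two vertices; different edges have different sets of endpoints; the interior of an edge contains no vertex and no point of any other edge. We write $\{u,v\}\in E$ if there is an edge with endpoints $u,v$. A graph automorphism is a bijection $\phi:V\to V$ with $\{u,v\}\in E\iff\{\phi(u),\phi(v)\}\in E$. $G$ is transitive if for any $u,v\in V$ there is a graph automorphism mapping $u$ to $v$. $G$ is quasi-transitive if $V$ can be partitioned into finitely many sets $V_1,\dots,V_N$ such that for every $i$ and every $u,v\in V_i$ there is a graph automorphism mapping $u$ to $v$. *)

(* Defs.v *)
From mathcomp Require Export all_boot all_order all_algebra.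
From mathcomp Require Export all_classical all_reals all_analysis.
Export Order.TTheory GRing.Theory Num.Theory.
Export numFieldNormedType.Exports.

Set Implicit Arguments.
Unset Strict Implicit.
Unset Printing Implicit Defensive.

#[global] Open Scope classical_set_scope.
#[global] Open Scope ring_scope.

(* The product topology on R * R is that of the Euclidean plane, but the
   library's norm and balls on R * R are those of the sup norm, so that the
   Euclidean disc is defined explicitly. *)
Notation plane R := (R * R)%type (only parsing).

Definition disc (R : realType) (c : plane R) (r : R) : set (plane R) :=
  [set p | Num.sqrt ((p.1 - c.1) ^+ 2 + (p.2 - c.2) ^+ 2) < r].

Definition rotation (R : realType) (O : plane R) (theta : R) (p : plane R) :
    plane R :=
  (O.1 + (cos theta * (p.1 - O.1) - sin theta * (p.2 - O.2)),
   O.2 + (sin theta * (p.1 - O.1) + cos theta * (p.2 - O.2))).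

Definition segment (R : realType) (p q : plane R) : set (plane R) :=
  [set p + t *: (q - p) | t in `[0 : R, 1]].

Definition homeomorphism_on (S T : topologicalType) (A : set S) (B : set T)
    (f : S -> T) : Prop :=
  set_bij A B f /\ {within A, continuous f} /\
  exists g : T -> S, {in A, cancel f g} /\ {within B, continuous g}.

Definition arc (R : realType) (A : set (plane R)) : Prop :=
  (exists s : seq (plane R * plane R),
     (forall pq, pq \in s -> pq.1 != pq.2) /\
     A = \bigcup_(pq in [set` s]) segment pq.1 pq.2) /\
  (exists f : R -> plane R, homeomorphism_on `[0 : R, 1] A f).

(* For an arc A, the set of endpoints f 0, f 1 is the same for all
   homeomorphisms f from [0, 1] onto A. *)
Definition endpoints (R : realType) (A : set (plane R)) : set (plane R) :=
  [set x | exists f : R -> plane R,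
     homeomorphism_on `[0 : R, 1] A f /\ (x = f 0 \/ x = f 1)].

Definition arc_interior (R : realType) (A : set (plane R)) : set (plane R) :=
  A `\` endpoints A.

Record plane_graph (R : realType) := PlaneGraph {
  vertices : set (plane R);
  edges : set (set (plane R));
  countable_vertices : countable vertices;
  edge_arc : forall e, edges e -> arc e;
  edge_endpoints : forall e, edges e -> endpoints e `<=` vertices;
  edge_endpoints_inj : forall e e', edges e -> edges e' ->
    endpoints e = endpoints e' -> e = e';
  edge_interior_vertices : forall e, edges e ->
    arc_interior e `&` vertices = set0;
  edge_interior_edges : forall e e', edges e -> edges e' -> e <> e' ->
    arc_interior e `&` e' = set0
}.

Definition adjacent (R : realType) (G : plane_graph R) (u v : plane R) : Prop :=
  exists2 e, edges G e & endpoints e = [set u; v].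

Definition connected_graph (R : realType) (G : plane_graph R) : Prop :=
  forall u v, vertices G u -> vertices G v ->
  exists2 s : seq (plane R),
    path (fun x y => `[< adjacent G x y >]) u s & last u s = v.

Definition preserves_adjacency (R : realType) (G : plane_graph R)
    (f : plane R -> plane R) : Prop :=
  forall u v, vertices G u -> vertices G v ->
    adjacent G u v <-> adjacent G (f u) (f v).

(* Only the restriction of phi to the vertex set matters. *)
Definition graph_automorphism (R : realType) (G : plane_graph R)
    (phi : plane R -> plane R) : Prop :=
  set_bij (vertices G) (vertices G) phi /\ preserves_adjacency G phi.

Definition same_orbit (R : realType) (G : plane_graph R) (u v : plane R) :
    Prop :=
  exists2 phi, graph_automorphism G phi & phi u = v.

Definition transitive_graph (R : realType) (G : plane_graph R) : Prop :=
  forall u v, vertices G u -> vertices G v -> same_orbit G u v.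

Definition quasi_transitive_graph (R : realType) (G : plane_graph R) : Prop :=
  exists (N : nat) (W : 'I_N -> set (plane R)),
    classical_sets.partition [set: 'I_N] W (vertices G) /\
    forall i u v, W i u -> W i v -> same_orbit G u v.

(* Main.v *)
(* Let L be the set of vectors whose translation preserves the graph. It is
   stable under the linear part r of the rotation and, vertices being locally
   finite, discrete; so r has finite order on each w in L, and since the sum of
   the cycle w, r w, r^2 w, ... is fixed by r it vanishes, whence - w is in L.
   As r w + r^-1 w = 2 cos(theta) w, the number 2 cos(theta) maps the discrete
   group L into itself, which forces it to be an integer. When theta < pi, L
   contains the rank two lattice spanned by x and r x, whose fundamental
   parallelogram contains finitely many vertices, so that there are finitely many
   orbits. *)
Require Import Defs.
From mathcomp Require Import ring lra zify.

Set Implicit Arguments.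
Unset Strict Implicit.
Unset Printing Implicit Defensive.

(** * Orbits inside finite sets *)

Lemma pigeonhole_nat (T : Type) (A : set T) (f : nat -> T) :
  finite_set A -> (forall n, A (f n)) -> exists i j, (i < j)%N /\ f i = f j.
Proof.
move=> finA fA; apply: contrapT => nex; apply: infinite_nat.
have -> : [set: nat] = f @^-1` A by apply/seteqP; split => // n _; exact: fA.
apply: finite_preimage => // i j _ _ fij.
case: (ltngtP i j) => // lij; exfalso; apply: nex.
  by exists i, j.
by exists j, i.
Qed.

(** Two iterates coincide by pigeonhole, and injectivity cancels the smaller number of iterations
    from both. The exponent [m.+1] keeps the period positive. *)
Lemma finite_orbit_periodic (T : Type) (A : set T) (f : T -> T) (x : T) :
  finite_set A -> injective f -> (forall n, A (iter n f x)) ->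
  exists m, iter m.+1 f x = x.
Proof.
move=> finA injf Af.
have [i [j [lij eij]]] := pigeonhole_nat finA Af.
exists (j - i).-1; rewrite prednK ?subn_gt0//.
have injn n : injective (iter n f) by elim: n => //= n IH y z /injf/IH.
by apply: (injn i); rewrite -iterD subnKC 1?ltnW.
Qed.

(** * The Euclidean norm and plane rotations *)

Definition sqnorm (R : realType) (p : plane R) : R := p.1 ^+ 2 + p.2 ^+ 2.

(** The radius exceeds the square root of [K] because discs are open while the bound on [w] is not
    strict. *)
Lemma disc_sqnorm (R : realType) (c w : plane R) (K : R) :
  sqnorm w <= K -> disc c (Num.sqrt (K + 1)) (c + w).
Proof.
move=> wK; rewrite /disc /=.
have K0 : 0 <= K by apply: le_trans wK; rewrite addr_ge0 ?sqr_ge0.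
rewrite ltr_sqrt; last by rewrite ltr_wpDl.
by rewrite (addrC c.1) (addrC c.2) !addrK (le_lt_trans wK)// ltrDl.
Qed.

Section Rotation.
Context (R : realType) (theta : R).

Lemma rotationD (O p w : plane R) :
  rotation O theta (p + w) = rotation O theta p + rotation 0 theta w.
Proof. by rewrite /rotation /=; congr pair => /=; ring. Qed.

Lemma rotation_center (O p : plane R) :
  rotation O theta p = O + rotation 0 theta (p - O).
Proof. by rewrite /rotation /=; congr pair => /=; ring. Qed.

Lemma rotation0D (p w : plane R) :
  rotation 0 theta (p + w) = rotation 0 theta p + rotation 0 theta w.
Proof. exact: rotationD. Qed.

Lemma sqnorm_rotation (p : plane R) : sqnorm (rotation 0 theta p) = sqnorm p.
Proof.
have cs := cos2Dsin2 theta.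
transitivity ((cos theta ^+ 2 + sin theta ^+ 2) * sqnorm p).
  by rewrite /sqnorm /rotation /=; ring.
by rewrite cs mul1r.
Qed.

Lemma sqnorm_eq0 (p : plane R) : sqnorm p = 0 -> p = 0.
Proof.
move/eqP; rewrite paddr_eq0 ?sqr_ge0// !sqrf_eq0 => /andP[/eqP p1 /eqP p2].
by case: p p1 p2 => /= ? ? -> ->.
Qed.

Lemma rotation_inj (O : plane R) : injective (rotation O theta).
Proof.
move=> p q pq; have := rotationD O q (p - q).
rewrite [q + _]addrC subrK pq => /eqP; rewrite -[X in X == _]addr0.
rewrite (inj_eq (addrI _)) eq_sym => /eqP/(congr1 (@sqnorm R)).
rewrite sqnorm_rotation [RHS]/sqnorm /= expr0n addr0 => /sqnorm_eq0/eqP.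
by rewrite subr_eq0 => /eqP.
Qed.

Lemma sqnorm_iter_rotation n (p : plane R) :
  sqnorm (iter n (rotation 0 theta) p) = sqnorm p.
Proof. by elim: n => //= n IH; rewrite sqnorm_rotation. Qed.

Lemma iter_rotation_center n (O p : plane R) :
  iter n (rotation O theta) p = O + iter n (rotation 0 theta) (p - O).
Proof.
elim: n => [|n IH] /=; first by rewrite addrC subrK.
by rewrite rotation_center IH addrAC subrr add0r.
Qed.

(** The linear rotation minus the identity has determinant [2 - 2 * cos theta], which is nonzero
    here. *)
Lemma rotation_fixed (p : plane R) :
  cos theta != 1 -> rotation 0 theta p = p -> p = 0.
Proof.
move=> c1 fp; have cs := cos2Dsin2 theta.
have [f1 f2] : (rotation 0 theta p).1 = p.1 /\ (rotation 0 theta p).2 = p.2.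
  by rewrite fp.
move: f1 f2; rewrite /rotation /= !subr0 !add0r => f1 f2.
have c0 : 1 - cos theta != 0 by rewrite subr_eq0 eq_sym.
have e1 : (1 - cos theta) * p.1 = 0.
  have : (2 - cos theta * 2) * p.1 = 0 by nra.
  lra.
have e2 : (1 - cos theta) * p.2 = 0 by nra.
move: e1 e2 => /eqP + /eqP; rewrite !mulf_eq0 (negPf c0) /= => /eqP p1 /eqP p2.
by case: p p1 p2 {fp f1 f2} => /= ? ? -> ->.
Qed.

(** This is Cayley-Hamilton for the linear rotation, whose trace is [2 * cos theta] and whose
    determinant is 1. *)
Lemma rotation_trace (p : plane R) :
  rotation 0 theta (rotation 0 theta p) + p =
  (2 * cos theta) *: rotation 0 theta p.
Proof.
have mulcs (y : R) : y = (cos theta ^+ 2 + sin theta ^+ 2) * y.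
  by rewrite cos2Dsin2 mul1r.
by rewrite /rotation /=; congr pair; rewrite /GRing.scale /= ?subr0 ?add0r
   [X in _ + X = _]mulcs; ring.
Qed.

(* The sum of a cycle of the linear rotation is a fixed point. *)
Lemma sum_rotation_cycle m (w : plane R) :
  cos theta != 1 -> iter m (rotation 0 theta) w = w ->
  \sum_(k < m) iter k (rotation 0 theta) w = 0.
Proof.
move=> c1 cyc; apply: rotation_fixed => //.
have rsum n : rotation 0 theta (\sum_(k < n) iter k (rotation 0 theta) w) =
    \sum_(k < n) iter k.+1 (rotation 0 theta) w.
  elim: n => [|n IH]; last by rewrite !big_ord_recr /= rotation0D IH.
  by rewrite !big_ord0 /rotation /=; congr pair => /=; ring.
(* Rotation shifts the indices by one. After adding [w], both sides are the sum of the iterates 0 to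
   [m], with the first or the last term split off; these two terms agree by [cyc]. *)
apply: (addrI w); rewrite rsum.
by have := @big_ord_recl _ 0 +%R m (fun k => iter k (rotation 0 theta) w);
  rewrite big_ord_recr /= cyc addrC => ->.
Qed.

End Rotation.

(** * Translation symmetries and their interplay with the rotation *)

(** Only an inclusion is demanded, as in (C1), so that these vectors form a priori just a monoid. *)
Definition translation_symmetry (R : realType) (G : plane_graph R)
    (w : plane R) : Prop :=
  [set v + w | v in vertices G] `<=` vertices G /\
  preserves_adjacency G (fun v => v + w).

Section Symmetry.
Context (R : realType) (G : plane_graph R).
Hypothesis C3 : forall (c : plane R) (r : R), finite_set (vertices G `&` disc c r).
Local Notation V := (vertices G).
Local Notation L := (translation_symmetry G).

Lemma translation_symmetry0 : L 0.
Proof.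
split; first by move=> _ [v Vv <-]; rewrite addr0.
by move=> u v _ _; rewrite !addr0.
Qed.

Lemma translation_symmetryD w w' : L w -> L w' -> L (w + w').
Proof.
move=> [Vw aw] [Vw' aw'].
have stab u : V u -> V (u + w) by move=> Vu; apply: Vw; exists u.
split.
  by move=> _ [v Vv <-]; rewrite addrA; apply: Vw'; exists (v + w); first exact: stab.
by move=> u v Vu Vv; rewrite !addrA aw// aw'//; exact: stab.
Qed.

Lemma translation_symmetry_auto w : L w -> L (- w) ->
  graph_automorphism G (fun v => v + w).
Proof.
move=> [Vw aw] [VNw _]; split => //; split.
- by move=> v Vv; apply: Vw; exists v.
- by move=> u v _ _ /addIr.
- by move=> v Vv; exists (v - w); [apply: VNw; exists v|rewrite subrK].
Qed.

(** A symmetry vector is determined by the image of [v0], which is one of the finitely many vertices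
    in a disc around [v0]. *)
Lemma translation_symmetry_discrete (v0 : plane R) K : V v0 ->
  finite_set [set w | L w /\ sqnorm w <= K].
Proof.
move=> Vv0; pose r := Num.sqrt (K + 1).
apply: (@sub_finite_set _ _ ((fun w => v0 + w) @^-1` (V `&` disc v0 r))).
  move=> w [[Vw _] wK]; split; first by apply: Vw; exists v0.
  exact: disc_sqnorm.
by apply: finite_preimage => // u v _ _ /addrI.
Qed.

(** The rotation preserves the distance to [O], so the orbit of a vertex stays among finitely many
    vertices and is a cycle; the vertex is the image of its predecessor in the cycle. *)
Lemma rotation_onto (O : plane R) theta :
  rotation O theta @` V `<=` V -> V `<=` rotation O theta @` V.
Proof.
move=> RV v Vv.
have itV n : V (iter n (rotation O theta) v).
  by elim: n => //= n IH; apply: RV; exists (iter n (rotation O theta) v).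
pose A := V `&` disc O (Num.sqrt (sqnorm (v - O) + 1)).
have itA n : A (iter n (rotation O theta) v).
  split => //; rewrite iter_rotation_center; apply: disc_sqnorm.
  by rewrite sqnorm_iter_rotation.
have [m mv] := finite_orbit_periodic (C3 _ _ : finite_set A) (@rotation_inj _ _ _) itA.
by exists (iter m (rotation O theta) v).
Qed.

Section RotationSymmetry.
Context (O : plane R) (theta : R).
Hypothesis RV : rotation O theta @` V `<=` V.
Hypothesis Radj : preserves_adjacency G (rotation O theta).
Hypothesis c1 : cos theta != 1.
Hypothesis V0 : V !=set0.

(* Conjugating a translation by the rotation rotates its vector. *)
Lemma translation_symmetry_rotation w : L w -> L (rotation 0 theta w).
Proof.
move=> [Vw aw].
have stab u : V u -> V (u + w) by move=> Vu; apply: Vw; exists u.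
split.
  move=> _ [_ /(rotation_onto RV)[u Vu <-] <-].
  by rewrite -rotationD; apply: RV; exists (u + w) => //; exact: stab.
move=> _ _ /(rotation_onto RV)[u Vu <-] /(rotation_onto RV)[v Vv <-].
by rewrite -!rotationD -Radj// -Radj//; [exact: aw|exact: stab|exact: stab].
Qed.

Lemma translation_symmetry_iter n w : L w -> L (iter n (rotation 0 theta) w).
Proof. by move=> Lw; elim: n => //= n; exact: translation_symmetry_rotation. Qed.

Lemma translation_symmetry_periodic w :
  L w -> exists m, iter m.+1 (rotation 0 theta) w = w.
Proof.
move=> Lw; have [v0 Vv0] := V0.
have := finite_orbit_periodic (translation_symmetry_discrete (sqnorm w) Vv0)
  (@rotation_inj R theta 0); apply => n.
by split; [exact: translation_symmetry_iter|rewrite sqnorm_iter_rotation].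
Qed.

Lemma translation_symmetryN w : L w -> L (- w).
Proof.
move=> Lw; have [m mw] := translation_symmetry_periodic Lw.
have /eqP := sum_rotation_cycle c1 mw.
(* Splitting off the term of index 0 from the vanishing sum writes [- w] as the sum of the other
   iterates. *)
rewrite big_ord_recl /= addr_eq0 => /eqP/(congr1 -%R); rewrite opprK => ->.
apply: big_ind => [|? ?|i _].
- exact: translation_symmetry0.
- exact: translation_symmetryD.
- exact: (translation_symmetry_iter (bump 0 i)).
Qed.

Lemma translation_symmetryMz w (n : int) : L w -> L (n%:~R *: w).
Proof.
move=> Lw.
have Lnat k : L (w *+ k).
  elim: k => [|k IH]; first exact: translation_symmetry0.
  by rewrite mulrS; exact: translation_symmetryD.
rewrite scaler_int; case: n => k; first exact: Lnat.
by rewrite NegzE mulrNz; apply: translation_symmetryN; exact: Lnat.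
Qed.

Lemma translation_symmetry_trace w : L w -> L ((2 * cos theta) *: w).
Proof.
move=> Lw; have [m mw] := translation_symmetry_periodic Lw.
(* The iterate of order [m] serves as the inverse rotation of [w]; the trace identity is applied to
   it. *)
rewrite -{1}mw /= -rotation_trace -iterS mw.
apply: translation_symmetryD; first exact: translation_symmetry_rotation.
exact: translation_symmetry_iter.
Qed.

(* The vectors [f ^+ k *: w], with [f] the fractional part of [2 * cos theta],
   are bounded translation symmetries, hence finitely many. *)
Lemma crystallographic_restriction w : L w -> w != 0 ->
  exists n : int, 2 * cos theta = n%:~R.
Proof.
move=> Lw w0; have [v0 Vv0] := V0.
pose n := Num.floor (2 * cos theta); exists n.
pose f := 2 * cos theta - n%:~R.
have /andP[nle nlt] := floor_itv (2 * cos theta).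
rewrite intrD in nlt.
have f0 : 0 <= f by rewrite subr_ge0.
have f1 : f < 1 by rewrite ltrBlDl.
have Lf k : L (f ^+ k *: w).
  elim: k => [|k IH]; first by rewrite expr0 scale1r.
  (* Multiplication by [f] is the trace map minus an integer multiple, and both preserve symmetry
     vectors. *)
  rewrite exprS -scalerA scalerBl; apply: translation_symmetryD.
    exact: translation_symmetry_trace.
  by apply: translation_symmetryN; exact: translation_symmetryMz.
have bf k : sqnorm (f ^+ k *: w) <= sqnorm w.
  have -> : sqnorm (f ^+ k *: w) = (f ^+ k) ^+ 2 * sqnorm w.
    by rewrite /sqnorm /= /GRing.scale /=; ring.
  by rewrite ler_piMl ?addr_ge0 ?sqr_ge0// -exprM exprn_ile1 // ltW.
have [i [j [lij eij]]] :=
  pigeonhole_nat (translation_symmetry_discrete (sqnorm w) Vv0)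
    (fun k => conj (Lf k) (bf k)).
(* If [f] were nonzero, its powers would strictly decrease, against the coincidence of the vectors
   of indices [i] and [j]. *)
apply/eqP; rewrite -subr_eq0 -/f; apply: contraT => fn0.
have fgt0 : 0 < f by rewrite lt_def fn0.
move: eij => /eqP; rewrite -subr_eq0 -scalerBl scaler_eq0 (negPf w0) orbF.
by rewrite subr_eq0 eq_sym lt_eqF// ltr_iXn2l.
Qed.

(* The vertex [u] is the translate of [v] into the fundamental parallelogram
   spanned by [w] and its rotation. *)
Lemma translation_bounded_representative w v :
  L w -> w != 0 -> sin theta != 0 -> V v ->
  exists u, [/\ V u, sqnorm u <= 4 * sqnorm w & same_orbit G v u].
Proof.
move=> Lw w0 s0 Vv; set c := cos theta; set s := sin theta in s0 *.
have N0 : sqnorm w != 0 by apply: contraNN w0 => /eqP/sqnorm_eq0/eqP.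
(* The coordinates of [v] in the basis formed by [w] and its rotation: [b] comes from the
   determinant of [w] and [v], then [a] from their scalar product. *)
pose b := (w.1 * v.2 - w.2 * v.1) / (s * sqnorm w).
pose a := (w.1 * v.1 + w.2 * v.2) / sqnorm w - c * b.
have vE : v = a *: w + b *: rotation 0 theta w.
  rewrite /a /b [LHS]surjective_pairing /rotation /= -/c -/s.
  move: N0; rewrite /sqnorm => N0.
  by congr pair => /=; rewrite /GRing.scale /=; field; rewrite s0 N0.
pose m := Num.floor a; pose n := Num.floor b.
pose t := - (m%:~R *: w + n%:~R *: rotation 0 theta w).
have LNt : L (- t).
  rewrite opprK; apply: translation_symmetryD; apply: translation_symmetryMz => //.
  exact: translation_symmetry_rotation.
have Lt : L t by rewrite -[t]opprK; exact: translation_symmetryN.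
exists (v + t); split; last by exists (fun v => v + t) => //; exact: translation_symmetry_auto.
  by apply: (proj1 Lt); exists v.
have /andP[] := floor_itv a; have /andP[] := floor_itv b; rewrite !intrD -/m -/n.
move: (m%:~R : R) (n%:~R : R) @t {LNt Lt} => M N t bN Nb aM Ma.
(* The Gram form of the basis, evaluated at the fractional parts of [a] and [b]. These lie in [0, 1]
   and [c] is at most 1, whence the factor 4. *)
have -> : sqnorm (v + t) =
   ((a - M) ^+ 2 + (b - N) ^+ 2 * (c ^+ 2 + s ^+ 2) + (a - M) * (b - N) * c *+ 2) * sqnorm w.
  rewrite vE /t /sqnorm /rotation /= -/c -/s /GRing.scale /=; ring.
rewrite cos2Dsin2 mulr1 ler_wpM2r ?addr_ge0 ?sqr_ge0//.
have c_le1 : c <= 1 := cos_le1 theta.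
have c_geN1 : -1 <= c := cos_geN1 theta.
have : 0 <= a - M <= 1 by apply/andP; split; lra.
have : 0 <= b - N <= 1 by apply/andP; split; lra.
move: (a - M) (b - N) => x y /andP[y0 y1] /andP[x0 x1].
have xy0 : 0 <= x * y by rewrite mulr_ge0.
have xyc : x * y * c <= x * y by rewrite ler_piMr.
nra.
Qed.

End RotationSymmetry.
End Symmetry.

(** * Orbits of automorphisms and quasi-transitivity *)

Lemma same_orbit_refl (R : realType) (G : plane_graph R) u : same_orbit G u u.
Proof. by exists id => //; split => //; split => // v; exists v. Qed.

Lemma same_orbit_sym (R : realType) (G : plane_graph R) u v :
  vertices G u -> same_orbit G u v -> same_orbit G v u.
Proof.
move=> Vu [f [bf af] fu].
have [fV finj fsurj] := bf.
have [g] : exists g : plane R -> plane R,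
    forall y, vertices G y -> vertices G (g y) /\ f (g y) = y.
  have /choice[g gP] : forall y, exists x, vertices G y -> vertices G x /\ f x = y.
    (* Automorphisms are bijective on vertices only; elsewhere the inverse takes the arbitrary value
       [y]. *)
    move=> y; have [Vy|nVy] := pselect (vertices G y); last by exists y.
    by have [x Vx fx] := fsurj _ Vy; exists x.
  by exists g.
move=> gP.
have gK x : vertices G x -> g (f x) = x.
  move=> Vx; have [Vg fg] := gP _ (fV _ Vx).
  by apply: finj; rewrite ?inE.
exists g; last by rewrite -fu gK.
split; first split.
- by move=> y /gP[].
- move=> x y /set_mem/gP[_ {2}<-] /set_mem/gP[_ {2}<-].
  by move=> ->.
- by move=> x Vx; exists (f x); [exact: fV|exact: gK].
move=> x y /gP[Vgx {1}<-] /gP[Vgy {1}<-].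
by rewrite -af.
Qed.

Lemma same_orbit_trans (R : realType) (G : plane_graph R) u v w :
  same_orbit G u v -> same_orbit G v w -> same_orbit G u w.
Proof.
move=> [f [bf af] <-] [g [bg ag] <-]; exists (g \o f) => //; split.
  exact: set_bij_comp bf bg.
by move=> x y Vx Vy /=; rewrite af// ag//; case: bf => fV _ _; exact: fV.
Qed.

(** The classes are the orbits of the vertices in [A]: finitely many, and every vertex lies in one
    of them. *)
Lemma finitely_many_orbits_quasi_transitive (R : realType) (G : plane_graph R)
    (A : set (plane R)) : finite_set A ->
  (forall v, vertices G v ->
     exists u, [/\ A u, vertices G u & same_orbit G v u]) ->
  quasi_transitive_graph G.
Proof.
move=> finA repA.
pose orb (u : plane R) := vertices G `&` [set v | same_orbit G u v].
have /finite_seqP[s0 s0E] : finite_set (orb @` (A `&` vertices G)).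
  by apply: finite_image; exact: finite_setIl.
(* Without repetitions, distinct indices give distinct orbits, hence disjoint classes. *)
pose s := undup s0.
have sE X : X \in s <-> (orb @` (A `&` vertices G)) X by rewrite s0E /s mem_undup.
have orbP i : (i < size s)%N -> exists2 u, vertices G u & nth set0 s i = orb u.
  by move=> /(mem_nth set0)/sE[u [_ Vu] <-]; exists u.
have orb_eq u v x : vertices G u -> vertices G v -> orb u x -> orb v x ->
    orb u = orb v.
  move=> Vu Vv [Vx ux] [_ vx].
  have uv := same_orbit_trans ux (same_orbit_sym Vv vx).
  apply/seteqP; split => y [Vy oy]; split => //=.
    exact: same_orbit_trans (same_orbit_sym Vu uv) oy.
  exact: same_orbit_trans uv oy.
exists (size s), (fun i => nth set0 s i); split; last first.
  move=> i u v; have [x Vx ->] := orbP _ (ltn_ord i) => -[Vu xu] [_ xv].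
  exact: same_orbit_trans (same_orbit_sym Vx xu) xv.
split.
- apply/seteqP; split => v.
    by move=> [i _]; have [x Vx ->] := orbP _ (ltn_ord i) => -[].
  move=> Vv; have [u [Au Vu vu]] := repA _ Vv.
  have us : orb u \in s by apply/sE; exists u.
  exists (Ordinal (etrans (index_mem _ _) us)) => //=.
  by rewrite nth_index//; split => //; exact: same_orbit_sym.
- move=> i j _ _ [x []].
  have [u Vu iE] := orbP _ (ltn_ord i); have [v Vv jE] := orbP _ (ltn_ord j).
  rewrite iE jE => ux vx; apply/val_inj/eqP.
  by rewrite -(nth_uniq set0 (ltn_ord i) (ltn_ord j) (undup_uniq s0)) iE jE
    (orb_eq u v x).
- move=> i _; have [u Vu ->] := orbP _ (ltn_ord i).
  by exists u; split => //; exact: same_orbit_refl.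
Qed.

(** * Angles whose doubled cosine is an integer *)

Lemma cos_lt1 (R : realType) (theta : R) :
  0 < theta -> theta <= pi -> cos theta < 1.
Proof.
move=> t0 tpi; rewrite lt_neqAle cos_le1 andbT; apply/eqP => c1.
have /cos_inj theta0 : theta \in `[0, pi] by rewrite in_itv /= ltW.
by move: t0; rewrite (theta0 0) ?ltxx ?in_itv /= ?lexx ?pi_ge0 ?cos0.
Qed.

(** Doubling the angle gives its supplement, so the cosine [c] satisfies [2 * c ^+ 2 - 1 = - c];
    positivity selects the root 1/2 over -1. *)
Lemma cos_pi3 (R : realType) : cos (pi / 3 : R) = 1 / 2.
Proof.
have pi0 := pi_gt0 R.
have c0 : 0 < cos (pi / 3 : R) by apply: cos_gt0_pihalf; apply/andP; split; lra.
have := cos_mulr2n (pi / 3 : R).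
have -> : (pi / 3) *+ 2 = - (pi / 3) + pi :> R by field.
by rewrite cosDpi cosN; nra.
Qed.

Lemma cos_2pi3 (R : realType) : cos (2 / 3 * pi : R) = - (1 / 2).
Proof.
have -> : 2 / 3 * pi = - (pi / 3) + pi :> R by field.
by rewrite cosDpi cosN cos_pi3.
Qed.

(** The integer lies in [-2, 2), which leaves four values; the cosine is injective on [0, pi]. *)
Lemma cos_half_integer_angle (R : realType) (theta : R) (n : int) :
  0 < theta -> theta <= pi -> 2 * cos theta = n%:~R ->
  theta = pi / 3 \/ theta = pi / 2 \/ theta = 2 / 3 * pi \/ theta = pi.
Proof.
move=> t0 tpi nE.
have pi0 := pi_gt0 R.
have inj a : 0 <= a <= pi -> cos theta = cos a -> theta = a.
  by move=> a0; apply: cos_inj; rewrite in_itv //= ltW.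
have clt1 := cos_lt1 t0 tpi.
have n2 : n < 2 by rewrite -(ltr_int R) -nE; lra.
have nN2 : -2 <= n.
  by rewrite -(ler_int R) -nE; have := cos_geN1 theta; lra.
have : n = 1 \/ n = 0 \/ n = -1 \/ n = -2 by lia.
case=> [|[|[|]]] n_eq; rewrite n_eq in nE; [left|right; left|right; right; left|
  right; right; right]; apply: inj.
- by apply/andP; split; lra.
- by rewrite cos_pi3; lra.
- by apply/andP; split; lra.
- by rewrite cos_pihalf; lra.
- by apply/andP; split; lra.
- by rewrite cos_2pi3; lra.
- by apply/andP; split; lra.
- by rewrite cospi; lra.
Qed.

Theorem theorem1 (R : realType) (G : plane_graph R) (theta : R)
  (theta_gt0 : 0 < theta) (theta_le_pi : theta <= pi)
  (G_connected : connected_graph G)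
  (G_infinite : infinite_set (vertices G))
  (C1 : exists x : plane R, x != 0 /\
     [set v + x | v in vertices G] `<=` vertices G /\
     preserves_adjacency G (fun v => v + x))
  (C2 : exists O : plane R,
     rotation O theta @` vertices G `<=` vertices G /\
     preserves_adjacency G (rotation O theta))
  (C3 : forall (c : plane R) (r : R), finite_set (vertices G `&` disc c r)) :
  (theta = pi / 3 \/ theta = pi / 2 \/ theta = 2 / 3 * pi \/ theta = pi) /\
  (theta = pi / 3 \/ theta = pi / 2 \/ theta = 2 / 3 * pi ->
   transitive_graph G \/ quasi_transitive_graph G).
Proof.
have [x [x0 Lx]] := C1.
have [c [RV Radj]] := C2.
have V0 : vertices G !=set0 by exact: infinite_setN0.
have pi0 := pi_gt0 R.
have c1 : cos theta != 1 by rewrite lt_eqF ?cos_lt1.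
split.
  have [n nE] := crystallographic_restriction C3 RV Radj c1 V0 Lx x0.
  exact: cos_half_integer_angle nE.
move=> thetaE; right.
(* Excluding the angle pi makes [x] and its rotation linearly independent. *)
have s0 : sin theta != 0.
  have theta_pi : 0 < theta < pi by apply/andP; split; case: thetaE => [|[|]]; lra.
  by rewrite gt_eqF// sin_gt0_pi.
(* Every orbit meets the disc of radius [r] about the origin, by the bound on representatives in the
   fundamental parallelogram. *)
pose r := Num.sqrt (4 * sqnorm x + 1).
apply: (finitely_many_orbits_quasi_transitive (C3 0 r)) => v Vv.
have [u [Vu ux vu]] := translation_bounded_representative C3 RV Radj c1 V0 Lx x0 s0 Vv.
exists u; split => //; split => //.
by rewrite -[u]add0r; exact: disc_sqnorm.
Qed.
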